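(* Let $\mathcal{A}$ be a unital $C^*$-algebra. Then $\mathcal{M}\Phi(H_{\mathcal{A}}) = \mathcal{M}\Phi_+(H_{\mathcal{A}}) \cap \mathcal{M}\Phi_-(H_{\mathcal{A}})$.
   Context: $\mathcal{A}$ is a unital $C^*$-algebra; $H_{\mathcal{A}} = \ell^2(\mathcal{A})$ is the standard Hilbert $\mathcal{A}$-module, and $B^a(H_{\mathcal{A}})$ is the $C^*$-algebra of bounded adjointable $\mathcal{A}$-linear operators on it. $M \tilde\oplus N$ denotes a direct sum of closed submodules that is not necessarily orthogonal. A Hilbert module is finitely generated if it is the (algebraic) $\mathcal{A}$-linear span of a finite set. An isomorphism of Hilbert modules is a bounded $\mathcal{A}$-linear bijection (with bounded inverse). For $F \in B^a(H_{\mathcal{A}})$ consider closed submodules with $H_{\mathcal{A}} = M_1 \tilde\oplus N_1 = M_2 \tilde\oplus N_2$, $F(M_1) \subseteq M_2$, $F(N_1) \subseteq N_2$ and $F|_{M_1}: M_1 \to M_2$ an isomorphism. $F \in \mathcal{M}\Phi_+(H_{\mathcal{A}})$ if such a decomposition exists with $N_1$ finitely generated; $F \in \mathcal{M}\Phi_-(H_{\mathcal{A}})$ if such a decomposition exists with $N_2$ finitely generated; $F \in \mathcal{M}\Phi(H_{\mathcal{A}})$ ($F$ is $\mathcal{A}$-Fredholm) if a single such decomposition exists with both $N_1$ and $N_2$ finitely generated. *)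

(* Defs.v *)
From HB Require Import structures.
From mathcomp Require Import all_boot all_order all_algebra.
From mathcomp Require Import complex.
From mathcomp Require Import all_classical all_reals all_analysis.

Set Implicit Arguments.
Unset Strict Implicit.
Unset Printing Implicit Defensive.

Import Order.TTheory GRing.Theory Num.Theory.
Import numFieldNormedType.Exports.

Local Open Scope classical_set_scope.
Local Open Scope ring_scope.
Local Open Scope complex_scope.

(* Unital C*-algebras over C = R[i].  As usual for complex normed spaces in
   MathComp-Analysis, norms are nonnegative real elements of R[i].
   Hierarchy-Builder has no join of the algebra and normed module structures
   (it would have to be declared before numDomainType), so the product is part
   of the mixin, and the ring structure is then derived from it. *)
HB.mixin Record isCStarAlgebra (R : realType) A
    of CompleteNormedModule R[i] A := {
  cstar_one : A ;
  cstar_mul : A -> A -> A ;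
  star : A -> A ;
  cstar_mulA : associative cstar_mul ;
  cstar_mul1 : left_id cstar_one cstar_mul ;
  cstar_mulr1 : right_id cstar_one cstar_mul ;
  cstar_mulDl : left_distributive cstar_mul +%R ;
  cstar_mulDr : right_distributive cstar_mul +%R ;
  cstar_scaleAl : forall (c : R[i]) (x y : A),
    c *: cstar_mul x y = cstar_mul (c *: x) y ;
  cstar_scaleAr : forall (c : R[i]) (x y : A),
    c *: cstar_mul x y = cstar_mul x (c *: y) ;
  starK : involutive star ;
  starD : {morph star : x y / x + y} ;
  starZ : forall (c : R[i]) (x : A), star (c *: x) = c^* *: star x ;
  starM : forall x y : A, star (cstar_mul x y) = cstar_mul (star y) (star x) ;
  cstar_normM : forall x y : A, `|cstar_mul x y| <= `|x| * `|y| ;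
  cstar_identity : forall x : A, `|cstar_mul (star x) x| = `|x| ^+ 2
}.

#[short(type="cstarAlgType")]
HB.structure Definition CStarAlgebra (R : realType) :=
  {A of CompleteNormedModule R[i] A & isCStarAlgebra R A}.

HB.instance Definition _ (R : realType) (A : cstarAlgType R) :=
  GRing.Zmodule_isPzRing.Build (CStarAlgebra.sort A)
    (@cstar_mulA R A) (@cstar_mul1 R A) (@cstar_mulr1 R A)
    (@cstar_mulDl R A) (@cstar_mulDr R A).

Section StandardModule.
Variables (R : realType) (A : cstarAlgType R).
Implicit Types (x y : nat -> A) (M N : set (nat -> A)).
Implicit Types F : (nat -> A) -> (nat -> A).

(* Hilbert modules are right A-modules, with inner products A-linear in the
   second variable.  Addition of sequences is the pointwise one. *)
Definition rscale x (a : A) : nat -> A := fun n => x n * a.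

Definition HA : set (nat -> A) :=
  [set x | cvgn (series (fun n => star (x n) * x n))].

Definition inner x y : A := limn (series (fun n => star (x n) * y n)).

Definition hnorm x : R[i] := sqrtC `|inner x x|.

Definition submodule M :=
  [/\ M `<=` HA, M 0, (forall x y, M x -> M y -> M (x + y))
    & (forall x a, M x -> M (rscale x a))].

Definition norm_closed M :=
  forall x, HA x ->
    (forall e : R[i], 0 < e -> exists2 y, M y & hnorm (x - y) < e) -> M x.

Definition closed_submodule M := submodule M /\ norm_closed M.

(* Algebraic direct sum of closed submodules, with no orthogonality. *)
Definition HA_direct_sum M N :=
  [/\ closed_submodule M, closed_submodule N,
      HA = [set x + y | x in M & y in N] & M `&` N = [set 0]].

Definition finitely_generated N :=
  exists (n : nat) (g : 'I_n -> (nat -> A)),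
    N = [set \sum_(i < n) rscale (g i) (a i) | a in [set: 'I_n -> A]].

Definition linear_on M F :=
  (forall x y, M x -> M y -> F (x + y) = F x + F y) /\
  (forall x a, M x -> F (rscale x a) = rscale (F x) a).

Definition bounded_on M F :=
  exists c : R[i], forall x, M x -> hnorm (F x) <= c * hnorm x.

Definition isomorphism M N F :=
  [/\ linear_on M F, bounded_on M F, set_bij M N F
    & exists2 G : (nat -> A) -> (nat -> A),
        (forall x, M x -> G (F x) = x) & bounded_on N G].

Definition adjointable F :=
  exists2 G : (nat -> A) -> (nat -> A), G @` HA `<=` HA
    & forall x y, HA x -> HA y -> inner (F x) y = inner x (G y).

(* An operator on HA is encoded as a map on all sequences that vanishes
   outside HA, so that equality of encodings is equality of operators. *)
Definition Ba : set ((nat -> A) -> (nat -> A)) :=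
  [set F | [/\ F @` HA `<=` HA, (forall x, ~ HA x -> F x = 0),
               linear_on HA F, bounded_on HA F & adjointable F]].

Definition decomposition F M1 N1 M2 N2 :=
  [/\ HA_direct_sum M1 N1, HA_direct_sum M2 N2,
      F @` M1 `<=` M2, F @` N1 `<=` N2 & isomorphism M1 M2 F].

Definition MPhi_plus : set ((nat -> A) -> (nat -> A)) :=
  [set F | Ba F /\ exists M1 N1 M2 N2,
     decomposition F M1 N1 M2 N2 /\ finitely_generated N1].

Definition MPhi_minus : set ((nat -> A) -> (nat -> A)) :=
  [set F | Ba F /\ exists M1 N1 M2 N2,
     decomposition F M1 N1 M2 N2 /\ finitely_generated N2].

Definition MPhi : set ((nat -> A) -> (nat -> A)) :=
  [set F | Ba F /\ exists M1 N1 M2 N2,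
     [/\ decomposition F M1 N1 M2 N2, finitely_generated N1
       & finitely_generated N2]].

End StandardModule.
Arguments MPhi_plus {R} A.
Arguments MPhi_minus {R} A.
Arguments MPhi {R} A.

(* Main.v *)
Require Import Defs.
From mathcomp Require Import all_boot all_order all_algebra.
From mathcomp Require Import all_classical all_reals all_analysis.

Local Open Scope classical_set_scope.

(** The inclusion of the Fredholm operators in both semi-Fredholm classes is
    immediate.  For the converse, take for [F] a decomposition
    [M1 + N1 -> M2 + N2] with [N1] finitely generated and a decomposition
    [M1' + N1' -> M2' + N2'] with [N2'] finitely generated.  The first one
    already witnesses that [F] is Fredholm, because
    [N2 = F(N1) + P(N2')], where [P] is the projection onto [N2] along [M2]
    ([semiFredholm_complementE]).  Indeed [M2' = F(M1')] lies in
    [F(HA) = F(M1) + F(N1)], so [HA = M2' + N2'] is contained in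
    [M2 + F(N1) + N2']; applying [P] kills [M2], fixes [F(N1)], and gives the
    formula.  Linear images and sums of finitely generated submodules are
    finitely generated ([finitely_generated_image],
    [finitely_generated_sum]), hence so is [N2].

    Modulo operators with finitely generated range, the first decomposition
    gives [F] a left inverse and the second a right inverse; an element with
    both is invertible, and the formula for [N2] is this argument read off at
    the level of the decompositions, where it is purely algebraic. *)

Import GRing.Theory.
Local Open Scope ring_scope.

Section Decompositions.
Set Implicit Arguments.
Unset Strict Implicit.
Unset Printing Implicit Defensive.
Variables (R : realType) (A : cstarAlgType R).
Implicit Types (x y : nat -> A) (a b : A) (M N : set (nat -> A)).
Implicit Types F : (nat -> A) -> (nat -> A).

Lemma rscaleDl x y a : rscale (x + y) a = rscale x a + rscale y a.
Proof. by apply/funext => k; rewrite /rscale /= mulrDl. Qed.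

Lemma rscale0 x : rscale x 0 = 0.
Proof. by apply/funext => k; rewrite /rscale mulr0. Qed.

Lemma rscale1 x : rscale x 1 = x.
Proof. by apply/funext => k; rewrite /rscale mulr1. Qed.

Lemma rscaleN1 x : rscale x (- 1) = - x.
Proof. by apply/funext => k; rewrite /rscale mulrN1. Qed.

Lemma submoduleB M x y : submodule M -> M x -> M y -> M (x - y).
Proof.
by move=> [_ _ MD MZ] Mx My; apply: MD => //; rewrite -rscaleN1; apply: MZ.
Qed.

Lemma submodule_sum M n (g : 'I_n -> nat -> A) (a : 'I_n -> A) :
  submodule M -> (forall i, M (g i)) -> M (\sum_(i < n) rscale (g i) (a i)).
Proof.
move=> [_ M0 MD MZ] Mg.
by elim/big_ind : _ => // i _; apply: MZ.
Qed.

Lemma linear_on_sum M F n (g : 'I_n -> nat -> A) (a : 'I_n -> A) :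
  submodule M -> linear_on M F -> (forall i, M (g i)) ->
  F (\sum_(i < n) rscale (g i) (a i)) = \sum_(i < n) rscale (F (g i)) (a i).
Proof.
move=> sM [FD FZ]; have [_ M0 _ MZ] := sM.
elim: n g a => [|n IHn] g a Mg.
  by have := FZ _ 0 M0; rewrite !rscale0 !big_ord0 => ->.
rewrite !big_ord_recr /= FD ?FZ ?IHn //; first exact: submodule_sum.
exact: MZ.
Qed.

Lemma linear_on_sub M N F : N `<=` M -> linear_on M F -> linear_on N F.
Proof.
move=> NM [FD FZ]; split=> [x y /NM Mx /NM My|x a /NM Mx]; first exact: FD.
exact: FZ.
Qed.

Lemma generator_in_span n (g : 'I_n -> nat -> A) i :
  [set \sum_(j < n) rscale (g j) (a j) | a in [set: 'I_n -> A]] (g i).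
Proof.
exists (fun j => if j == i then 1 else 0) => //.
rewrite (bigD1 i) //= eqxx rscale1 big1 ?addr0 // => j /negbTE ->.
exact: rscale0.
Qed.

Lemma finitely_generated_image N F :
  submodule N -> linear_on N F -> finitely_generated N ->
  finitely_generated (F @` N).
Proof.
move=> sN linF [n [g NE]].
have Ng i : N (g i) by rewrite NE; apply: generator_in_span.
exists n, (fun i => F (g i)); apply/seteqP; split=> y /=.
- case=> x + <-; rewrite {1}NE => -[a _ <-].
  by exists a; rewrite // (linear_on_sum _ sN).
- case=> a _ <-; exists (\sum_(i < n) rscale (g i) (a i)).
    exact: submodule_sum.
  by rewrite (linear_on_sum _ sN).
Qed.

Lemma finitely_generated_sum N N' :
  finitely_generated N -> finitely_generated N' ->
  finitely_generated [set x + y | x in N & y in N'].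
Proof.
move=> [n [g ->]] [m [h ->]].
pose glue T (u : 'I_n -> T) (v : 'I_m -> T) (k : 'I_(n + m)) : T :=
  match fintype.split k with inl i => u i | inr j => v j end.
have glue_l T u v i : glue T u v (lshift m i) = u i.
  by rewrite /glue; case: split_ordP => j /eqP;
    rewrite (eq_lshift, eq_lrshift) // => /eqP ->.
have glue_r T u v j : glue T u v (rshift n j) = v j.
  by rewrite /glue; case: split_ordP => i /eqP;
    rewrite (eq_rlshift, eq_rshift) // => /eqP ->.
exists (n + m)%N, (glue _ g h); apply/seteqP; split=> z /=.
- case=> _ [a _ <-] [_ [b _ <-] <-].
  exists (glue _ a b) => //.
  by rewrite big_split_ord /=; congr (_ + _); apply: eq_bigr => i _;
    rewrite ?glue_l ?glue_r.
- case=> c _ <-; rewrite big_split_ord /=.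
  exists (\sum_(i < n) rscale (g i) (c (lshift m i))); first by eexists.
  exists (\sum_(j < m) rscale (h j) (c (rshift n j))); first by eexists.
  by congr (_ + _); apply: eq_bigr => i _; rewrite ?glue_l ?glue_r.
Qed.

Lemma direct_sum_unique M N x y x' y' :
  HA_direct_sum M N -> M x -> N y -> M x' -> N y' ->
  x + y = x' + y' -> y = y'.
Proof.
move=> [[sM _] [sN _] _ MN0] Mx Ny Mx' Ny' xy.
have dE : y - y' = x' - x.
  by apply/eqP; rewrite subr_eq addrAC -xy (addrC x) addrK.
have : (M `&` N) (y - y').
  by split; [rewrite dE|]; apply: submoduleB.
by rewrite MN0 /= => /eqP; rewrite subr_eq0 => /eqP.
Qed.

(** Choosing components pointwise yields a linear map because components are
    unique; outside [HA] the values are arbitrary. *)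
Lemma direct_sum_projection M N : HA_direct_sum M N ->
  exists P, [/\ linear_on (@HA R A) P, (forall x, HA x -> N (P x))
              & forall x y, M x -> N y -> P (x + y) = y].
Proof.
move=> MN; have [[[_ _ MD MZ] _] [[_ _ ND NZ] _] HE _] := MN.
have /choice[P PP] (x : nat -> A) :
    exists y, HA x -> N y /\ exists2 z, M z & x = z + y.
  have [|nHx] := pselect (HA x); last by exists 0.
  by rewrite {1}HE => -[z Mz [y Ny <-]]; exists y => _; split=> //; exists z.
have HMN x y : M x -> N y -> HA (x + y).
  by move=> Mx Ny; rewrite HE; exists x => //; exists y.
have PE x y : M x -> N y -> P (x + y) = y.
  move=> Mx Ny; have [NP [z Mz zE]] := PP _ (HMN _ _ Mx Ny).
  exact/esym/(direct_sum_unique MN Mx Ny Mz NP).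
exists P; split=> // [|x /PP[]//]; split=> [x y|x a].
- rewrite {1 2}HE => -[u Mu [v Nv <-]] [u' Mu' [v' Nv' <-]].
  by rewrite addrACA !PE //; [apply: MD|apply: ND].
- rewrite {1}HE => -[u Mu [v Nv <-]].
  by rewrite rscaleDl !PE //; [apply: MZ|apply: NZ].
Qed.

(** Expand [y] in [N2] along the primed decomposition as [F m' + q'], and then
    [m'] along [M1 + N1]: since [F(M1)] lies in [M2], only [F(N1)] and the
    [N2]-component of [q'] contribute to [y]. *)
Lemma semiFredholm_complementE F P M1 N1 M2 N2 M1' N1' M2' N2' :
  linear_on (@HA R A) F ->
  decomposition F M1 N1 M2 N2 -> decomposition F M1' N1' M2' N2' ->
  (forall x, HA x -> N2 (P x)) ->
  (forall x y, M2 x -> N2 y -> P (x + y) = y) ->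
  N2 = [set x + y | x in F @` N1 & y in P @` N2'].
Proof.
move=> [FD _] [MN1 MN2 FM FN _] [MN1' MN2' _ _ [_ _ [_ _ Fsurj] _]] PN PE.
have [[[M1H _ _ _] _] [[N1H _ _ _] _] HE1 _] := MN1.
have [[[_ _ M2D _] _] [[N2H _ N2D _] _] HE2 _] := MN2.
have [[[M1'H _ _ _] _] _ _ _] := MN1'.
have [_ [[N2'H _ _ _] _] HE2' _] := MN2'.
apply/seteqP; split=> [y N2y|_ [_ [n N1n <-] [_ [q N2'q <-] <-]]]; last first.
  by apply: N2D; [apply: FN; exists n|apply/PN/N2'H].
have : HA y by apply: N2H.
rewrite {1}HE2' => -[_ /Fsurj[m' M1'm' <-] [q' N2'q' yE]].
have : HA m' by apply: M1'H.
rewrite {1}HE1 => -[m M1m [n N1n m'E]].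
have : HA q' by apply: N2'H.
rewrite {1}HE2 => -[p M2p [r N2r q'E]].
have M2Fm : M2 (F m) by apply: FM; exists m.
have N2Fn : N2 (F n) by apply: FN; exists n.
have M20 : M2 0 by have [[[]]] := MN2.
exists (F n); first by exists n.
exists r; first by exists q' => //; rewrite -q'E PE.
have N2s : N2 (F n + r) by apply: N2D.
have M2s : M2 (F m + p) by apply: M2D.
apply: (direct_sum_unique MN2 M2s N2s M20 N2y).
have Fm'E : F m' = F m + F n by rewrite -m'E FD //; [apply: M1H|apply: N1H].
by rewrite add0r -yE Fm'E -q'E addrACA.
Qed.

End Decompositions.

Theorem corollary2p4 (R : realType) (A : cstarAlgType R) :
  MPhi A = MPhi_plus A `&` MPhi_minus A.
Proof.
apply/seteqP; split=> F.
  move=> [BF [M1 [N1 [M2 [N2 [dec fg1 fg2]]]]]].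
  by split; split=> //; exists M1, N1, M2, N2.
move=> [[BF [M1 [N1 [M2 [N2 [dec fg1]]]]]]].
move=> [_ [M1' [N1' [M2' [N2' [dec' fg2']]]]]].
split=> //; exists M1, N1, M2, N2; split=> //.
have [_ _ linF _ _] := BF.
have [[_ [sN1 _] _ _] MN2 _ _ _] := dec.
have [_ [_ [sN2' _] _ _] _ _ _] := dec'.
have [N1H _ _ _] := sN1; have [N2'H _ _ _] := sN2'.
have [P [linP PN PE]] := direct_sum_projection MN2.
rewrite (semiFredholm_complementE linF dec dec' PN PE).
apply: finitely_generated_sum; apply: finitely_generated_image => //.
- exact: linear_on_sub linF.
- exact: linear_on_sub linP.
Qed.
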